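(* Let $\alpha,\beta$ be real numbers with $\alpha>-1$, $\beta>-1$. Let $$L_0=2(1-x)\partial_xR+(\alpha+\beta+1-\alpha x^{-1})(1-R),$$ where $R$ is the reflection operator $Rf(x)=f(-x)$, and define operators on the space of polynomials in $x$ by $$X=\frac{L_0}{2}-\frac{1+\alpha+\beta}{2},\qquad Y=x,\qquad Z=(x-1)R,$$ where $Y$ is multiplication by $x$. Then $X,Y,Z$ satisfy the relations $$XY+YX=Z-\alpha,\qquad YZ+ZY=0,\qquad ZX+XZ=Y+\beta,$$ that is, the Askey–Wilson algebra relations $XY-qYX=\mu_3Z+\omega_3$, $YZ-qZY=\mu_1X+\omega_1$, $ZX-qXZ=\mu_2Y+\omega_2$ with $q=-1$, $\mu_1=0$, $\mu_2=\mu_3=1$, $\omega_1=0$, $\omega_2=\beta$, $\omega_3=-\alpha$. Moreover the Casimir operator $Q=Y^2+Z^2$ commutes with $X,Y,Z$, and in this realization $Q=I$, the identity operator.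
   Context: In $L_0$ and $Z$, operators compose from right to left ($\partial_xR$ means first apply $R$ and then differentiate; $(x-1)R$ means first apply $R$ and then multiply by $x-1$), and functions of $x$ act by multiplication; scalars denote multiples of the identity operator. $L_0$ maps polynomials to polynomials. *)

(* Defs.v *)
From HB Require Import structures.
From mathcomp Require Import all_boot all_order all_algebra.
From mathcomp Require Import reals ring.

Set Implicit Arguments.
Unset Strict Implicit.
Unset Printing Implicit Defensive.

Import Order.TTheory GRing.Theory Num.Theory.
Local Open Scope ring_scope.

Section Operators.
Variable R : realType.
Implicit Types (p : {poly R}) (a b : R).

Definition reflop p : {poly R} := p \Po (- 'X).

Fact reflop_is_linear : linear reflop.
Proof. by move=> a p q; rewrite /reflop comp_polyD comp_polyZ. Qed.
HB.instance Definition _ :=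
  GRing.isLinear.Build R {poly R} {poly R} _ reflop reflop_is_linear.

(* [p - reflop p] is an odd polynomial, so the Euclidean quotient by ['X]   *)
(* below is exact ([divX_odd_part]) and is the polynomial x^-1 (1 - R) p;   *)
(* [L0_horner] checks the resulting operator against the formula with x^-1. *)
Definition L0 a b p : {poly R} :=
  2 *: ((1 - 'X) * (reflop p)^`())
  + ((a + b + 1) *: (p - reflop p) - a *: ((p - reflop p) %/ 'X)).

Fact L0_is_linear a b : linear (L0 a b).
Proof.
move=> c p q; rewrite /L0 linearP derivD derivZ.
have -> : c *: p + q - (c *: reflop p + reflop q)
    = c *: (p - reflop p) + (q - reflop q).
  by rewrite scalerBr addrACA opprD.
rewrite divpD divpZl -!mul_polyC !(polyCD, polyCN).
by ring.
Qed.
HB.instance Definition _ a b :=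
  GRing.isLinear.Build R {poly R} {poly R} _ (L0 a b) (L0_is_linear a b).

Lemma divX_odd_part p : ((p - reflop p) %/ 'X) * 'X = p - reflop p.
Proof.
apply: divpK; rewrite -['X]subr0 -polyC0 dvdp_XsubCl /root.
by rewrite /reflop hornerD hornerN horner_comp hornerN hornerX oppr0 subrr.
Qed.

Lemma L0_horner a b p (x : R) : x != 0 ->
  (L0 a b p).[x] = 2 * (1 - x) * (p \Po (- 'X))^`().[x]
                   + (a + b + 1 - a * x^-1) * (p.[x] - p.[- x]).
Proof.
move=> x0; have := congr1 (fun q => q.[x]) (divX_odd_part p).
rewrite /L0 /reflop !(hornerM, hornerD, hornerN, hornerZ, hornerC, hornerX,
  horner_comp) => /(canRL (mulfK x0)) ->.
by field.
Qed.

Definition opX a b p : {poly R} :=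
  2^-1 *: L0 a b p - ((1 + a + b) / 2) *: p.

Fact opX_is_linear a b : linear (opX a b).
Proof.
move=> c p q; rewrite /opX L0_is_linear /= -!mul_polyC.
by ring.
Qed.
HB.instance Definition _ a b :=
  GRing.isLinear.Build R {poly R} {poly R} _ (opX a b) (opX_is_linear a b).

Definition opY p : {poly R} := 'X * p.

Fact opY_is_linear : linear opY.
Proof. by move=> c p q; rewrite /opY mulrDr scalerAr. Qed.
HB.instance Definition _ :=
  GRing.isLinear.Build R {poly R} {poly R} _ opY opY_is_linear.

Definition opZ p : {poly R} := ('X - 1) * reflop p.

Fact opZ_is_linear : linear opZ.
Proof. by move=> c p q; rewrite /opZ linearP mulrDr scalerAr. Qed.
HB.instance Definition _ :=
  GRing.isLinear.Build R {poly R} {poly R} _ opZ opZ_is_linear.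

Section AskeyWilson.
Variable V : lmodType R.
Implicit Types X Y Z : {linear V -> V}.

Definition AW_relations (q mu1 mu2 mu3 w1 w2 w3 : R) X Y Z : Prop :=
  [/\ (X \o Y) \- q \*: (Y \o X) =1 mu3 \*: Z \+ w3 \*: idfun,
      (Y \o Z) \- q \*: (Z \o Y) =1 mu1 \*: X \+ w1 \*: idfun
    & (Z \o X) \- q \*: (X \o Z) =1 mu2 \*: Y \+ w2 \*: idfun].

Definition casimir Y Z : V -> V := (Y \o Y) \+ (Z \o Z).

Definition op_commute (A B : V -> V) : Prop := A \o B =1 B \o A.

End AskeyWilson.
End Operators.

Arguments reflop {R}.
Arguments opY {R}.
Arguments opZ {R}.

(* Main.v *)
Require Import Defs.
From mathcomp Require Import all_boot all_order all_algebra.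
From mathcomp Require Import reals ring.

Set Implicit Arguments.
Unset Strict Implicit.
Unset Printing Implicit Defensive.

Import Order.TTheory GRing.Theory Num.Theory.
Local Open Scope ring_scope.

(** Put D = x^-1 (1 - R) and c = (1 + alpha + beta)/2. The identity part of [L0 / 2] cancels, so X =
    (1 - x) d/dx R - c R - (alpha/2) D ([opXE]). D interacts simply with the rest: R D = D, D Y = 1
    + R, D Z = 1 + R + D. After these rewrites each anticommutator is a polynomial identity modulo x
    D = 1 - R. That the Casimir commutes follows formally from the relations ([casimir_commute]); Q
    = I is a separate computation. *)

Lemma reflopM (R : realType) (p q : {poly R}) :
  reflop (p * q) = reflop p * reflop q.
Proof. exact: comp_polyM. Qed.

Lemma reflopC (R : realType) (c : R) : reflop c%:P = c%:P.
Proof. exact: comp_polyC. Qed.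

Lemma reflopX (R : realType) : reflop 'X = - 'X :> {poly R}.
Proof. exact: comp_polyX. Qed.

Lemma reflopK (R : realType) : involutive (@reflop R).
Proof.
by move=> p; rewrite /reflop -comp_polyA raddfN /= comp_polyX opprK comp_polyXr.
Qed.

Lemma deriv_reflop (R : realType) (p : {poly R}) :
  (reflop p)^`() = - reflop p^`().
Proof. by rewrite /reflop deriv_comp derivN derivX mulrN1. Qed.

Definition odd_quotient (R : realType) (p : {poly R}) : {poly R} :=
  (p - reflop p) %/ 'X.

Lemma odd_quotientM (R : realType) (p : {poly R}) :
  odd_quotient p * 'X = p - reflop p.
Proof. exact: divX_odd_part. Qed.

(** Together with [odd_quotientM], this replaces Euclidean division by an equation in all later
    computations. *)
Lemma odd_quotient_unique (R : realType) (p q : {poly R}) :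
  q * 'X = p - reflop p -> odd_quotient p = q.
Proof. by rewrite /odd_quotient => <-; rewrite mulpK ?polyX_eq0. Qed.

Lemma reflop_odd_quotient (R : realType) (p : {poly R}) :
  reflop (odd_quotient p) = odd_quotient p.
Proof.
(* Negating both sides turns the factor ['X] into [reflop 'X], so multiplicativity of [reflop]
   applies. *)
apply/esym/odd_quotient_unique/oppr_inj.
by rewrite -mulrN -reflopX -reflopM odd_quotientM linearB /= reflopK opprB.
Qed.

Lemma odd_quotient_opY (R : realType) (p : {poly R}) :
  odd_quotient (opY p) = p + reflop p.
Proof. by apply: odd_quotient_unique; rewrite /opY reflopM reflopX; ring. Qed.

Lemma reflop_opZ (R : realType) (p : {poly R}) :
  reflop (opZ p) = - ('X + 1) * p.
Proof.
by rewrite /opZ reflopM reflopK linearB /= reflopX -polyC1 reflopC; ring.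
Qed.

(** (1 - R) Z = (x - 1) R + (x + 1) = x (1 + R) + (1 - R); divide by x. *)
Lemma odd_quotient_opZ (R : realType) (p : {poly R}) :
  odd_quotient (opZ p) = p + reflop p + odd_quotient p.
Proof.
apply: odd_quotient_unique.
by rewrite mulrDl odd_quotientM reflop_opZ /opZ; ring.
Qed.

(* The part of [L0 / 2] proportional to the identity cancels against the *)
(* constant subtracted in [opX]. *)
Lemma opXE (R : realType) (a b : R) (p : {poly R}) :
  opX a b p = (1 - 'X) * (reflop p)^`() - ((1 + a + b) / 2)%:P * reflop p
              - (a / 2)%:P * odd_quotient p.
Proof.
have two0 : 2%:R != 0 :> R by rewrite pnatr_eq0.
rewrite /opX /L0 -/(odd_quotient p) scalerDr scalerA mulVf // scale1r.
rewrite scalerBr !scalerA -!mul_polyC (mulrC 2^-1 a).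
rewrite (_ : 2^-1 * (a + b + 1) = (1 + a + b) / 2); last by field.
by ring.
Qed.

Lemma opXY_anticomm (R : realType) (a b : R) (p : {poly R}) :
  opX a b (opY p) + opY (opX a b p) = opZ p - a *: p.
Proof.
rewrite !opXE odd_quotient_opY /opY /opZ reflopM reflopX derivM derivN derivX.
(* The scalar a is split so that only the constant a/2 of [opXE] occurs. *)
rewrite -mul_polyC [in RHS](splitr a) polyCD.
have := odd_quotientM p; move: (odd_quotient p) => d dX.
ring: dX.
Qed.

Lemma opYZ_anticomm (R : realType) (p : {poly R}) :
  opY (opZ p) + opZ (opY p) = 0.
Proof. by rewrite /opZ /opY reflopM reflopX; ring. Qed.

(** The derivatives of p cancel. What remains is (x - 1) p + 2 c p - (a/2) (x D p + p + R p), with c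
    = (1 + a + b)/2, and x D p = p - R p reduces the last term to a p. *)
Lemma opZX_anticomm (R : realType) (a b : R) (p : {poly R}) :
  opZ (opX a b p) + opX a b (opZ p) = opY p + b *: p.
Proof.
have reflX : reflop (opX a b p) = - (1 + 'X) * p^`()
    - ((1 + a + b) / 2)%:P * p - (a / 2)%:P * odd_quotient p.
  rewrite opXE !linearB /= !reflopM !reflopC reflopK reflop_odd_quotient.
  rewrite deriv_reflop !linearN /= reflopK linearB /= -polyC1 reflopC reflopX.
  by ring.
rewrite /opZ reflX -/(opZ p) opXE odd_quotient_opZ reflop_opZ.
rewrite derivM derivN derivD derivX -polyC1 derivC polyC1.
have bE : b = (1 + a + b) / 2 + (1 + a + b) / 2 - (a / 2 + a / 2) - 1 by field.
rewrite -mul_polyC [in RHS]bE !(polyCB, polyCD _ ((1 + a + b) / 2)).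
rewrite (polyCD (a / 2)) polyC1 /opY.
have := odd_quotientM p; move: (odd_quotient p) => d dX.
ring: dX.
Qed.

(** Z^2 = (x - 1)(-x - 1) = 1 - x^2. *)
Lemma casimir_op1 (R : realType) : casimir (@opY R) opZ =1 idfun.
Proof.
by move=> p; rewrite /casimir /= [opZ (opZ p)]/opZ reflop_opZ /opY; ring.
Qed.

(** Since Y and Z anticommute, each commutes with the square of the other. Moving X past Y^2 and
    past Z^2 leaves mu (ZY - YZ) and mu (YZ - ZY), which cancel because both relations carry the
    same mu. *)
Lemma casimir_commute (R : realType) (V : lmodType R) (mu w2 w3 : R)
    (X Y Z : {linear V -> V}) :
  AW_relations (-1) 0 mu mu 0 w2 w3 X Y Z ->
  [/\ op_commute (casimir Y Z) X, op_commute (casimir Y Z) Y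
    & op_commute (casimir Y Z) Z].
Proof.
case=> rXY rYZ rZX.
have XY v : X (Y v) = mu *: Z v + w3 *: v - Y (X v).
  by apply/eqP; rewrite eq_sym subr_eq -[_ + w3 *: v]rXY /= scaleN1r opprK.
have YZ v : Y (Z v) = - Z (Y v).
  have /= := rYZ v; rewrite !scale0r addr0 scaleN1r opprK => /eqP.
  by rewrite addr_eq0 => /eqP.
have XZ v : X (Z v) = mu *: Y v + w2 *: v - Z (X v).
  apply/eqP; rewrite eq_sym subr_eq -[_ + w2 *: v]rZX /= scaleN1r opprK.
  by rewrite addrC.
split=> v; rewrite /casimir /=.
(* Here b is the term in [w3] or [w2]: passing the same operator twice produces it with opposite
   signs. *)
- have move_past (a b c d : V) : a + b - (c + b - d) = d + (a - c).
    by rewrite opprB addrCA opprD addrACA subrr addr0.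
  have XYY : X (Y (Y v)) = Y (Y (X v)) + (mu *: Z (Y v) - mu *: Y (Z v)).
    by rewrite XY XY (linearB Y) (linearD Y) !(linearZZ Y) move_past.
  have XZZ : X (Z (Z v)) = Z (Z (X v)) + (mu *: Y (Z v) - mu *: Z (Y v)).
    by rewrite XZ XZ (linearB Z) (linearD Z) !(linearZZ Z) move_past.
  by rewrite linearD /= XYY XZZ addrACA -[mu *: Y (Z v) - _]opprB subrr addr0.
- by rewrite linearD /= YZ YZ linearN opprK.
- by rewrite linearD /= YZ linearN YZ opprK.
Qed.

Theorem mainTheorem5 (R : realType) (alpha beta : R)
    (halpha : -1 < alpha) (hbeta : -1 < beta) :
  let X : {linear {poly R} -> {poly R}} := opX alpha beta in
  let Y : {linear {poly R} -> {poly R}} := opY in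
  let Z : {linear {poly R} -> {poly R}} := opZ in
  [/\ [/\ (X \o Y) \+ (Y \o X) =1 Z \- alpha \*: idfun,
          (Y \o Z) \+ (Z \o Y) =1 \0
        & (Z \o X) \+ (X \o Z) =1 Y \+ beta \*: idfun],
      AW_relations (-1) 0 1 1 0 beta (- alpha) X Y Z,
      forall (V : lmodType R) (X' Y' Z' : {linear V -> V}),
        AW_relations (-1) 0 1 1 0 beta (- alpha) X' Y' Z' ->
        [/\ op_commute (casimir Y' Z') X',
            op_commute (casimir Y' Z') Y'
          & op_commute (casimir Y' Z') Z'],
      [/\ op_commute (casimir Y Z) X,
          op_commute (casimir Y Z) Y
        & op_commute (casimir Y Z) Z]
    & casimir Y Z =1 idfun].
Proof.
move=> X Y Z.
have rel : AW_relations (-1) 0 1 1 0 beta (- alpha) X Y Z.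
  split=> p /=; rewrite scaleN1r opprK ?scale1r.
  - by rewrite scaleNr opXY_anticomm.
  - by rewrite !scale0r addr0 opYZ_anticomm.
  - by rewrite opZX_anticomm.
split=> //.
- split=> p /=.
  + exact: opXY_anticomm.
  + exact: opYZ_anticomm.
  + exact: opZX_anticomm.
- by move=> V X' Y' Z'; apply: casimir_commute.
- exact: casimir_commute rel.
- exact: casimir_op1.
Qed.
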